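(* Let $1<p<2$ and let $K^{x_0}$ be an element of $\mathcal T_h$ whose closure contains $x_0$, of the form $K^{x_0}=x_0+h_{K^{x_0}}K_1$ with $K_1$ a fixed triangle satisfying $0\in\overline{K_1}$ and $\operatorname{diam}K_1=1$, so that $h_{K^{x_0}}$ is the diameter of $K^{x_0}$. Let $\mathbf q$ be a fixed field on a neighborhood of $x_0$, lying in $L^p$ there, with $\mathbf q(x_0+t(x-x_0))=t^{-1}\mathbf q(x)$ for $0<t\le1$ and not identically zero on $K^{x_0}$ (a condition independent of $h_{K^{x_0}}$ by that identity). Assume that on $K^{x_0}$ $$\boldsymbol{\sigma}=\mathbf q+\widetilde{\boldsymbol{\sigma}},\qquad \|\widetilde{\boldsymbol{\sigma}}\|_{L^p(K^{x_0})}=o\bigl(h_{K^{x_0}}^{2/p-1}\bigr).$$ Then there is $c>0$ such that $$\|\boldsymbol{\sigma}-\boldsymbol{\tau}_h\|_{L^p(\Omega)}\ge c\,h_{K^{x_0}}^{2/p-1}\qquad\text{for every }\boldsymbol{\tau}_h\in\mathrm{RT}_0(\mathcal T_h)$$ and all $h_{K^{x_0}}$ small enough. In particular $\|\boldsymbol{\sigma}-\boldsymbol{\sigma}_h\|_{L^p(\Omega)}\ge c\,h_{K^{x_0}}^{2/p-1}$.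
   Context: Continuous problem. $\Omega\subset\mathbb R^2$ is a bounded, simply connected Lipschitz domain, $x_0\in\Omega$, $1<p<2$. The matrix field $A\in L^\infty(\Omega;\mathbb R^{2\times 2})$ is symmetric and uniformly elliptic: $\alpha|\xi|^2\le\xi^TA(x)\xi\le\beta|\xi|^2$ for all $\xi\in\mathbb R^2$ and a.e. $x\in\Omega$, with $0<\alpha\le\beta$. Data: $f_1\in L^p(\Omega)$, $g\in W^{1-1/p,p}(\partial\Omega)$. It is assumed that $-\nabla\cdot(A\nabla u)=f_1+\delta_{x_0}$ in $\Omega$, $u=g$ on $\partial\Omega$, has a unique solution $u\in W^{1,p}(\Omega)$. Let $\mathbf f_2(x):=\frac1{2\pi}\frac{x-x_0}{|x-x_0|^2}$ (so $\nabla\cdot\mathbf f_2=\delta_{x_0}$ in the sense of distributions) and let $\boldsymbol{\sigma}:=-A\nabla u-\mathbf f_2\in L^p(\Omega)^2$ be the modified flux; it satisfies $\nabla\cdot\boldsymbol{\sigma}=f_1$. Discrete problem. $\mathcal T_h$ ranges over a family of shape-regular triangulations of $\Omega$. $\mathrm{RT}_0(\mathcal T_h)$ is the space of $\boldsymbol{\tau}_h\in H(\mathrm{div};\Omega)$ with $\boldsymbol{\tau}_h|_K(x)=\mathbf a+bx$, $\mathbf a\in\mathbb R^2$, $b\in\mathbb R$, on each $K\in\mathcal T_h$; $P_0(\mathcal T_h)$ is the space of piecewise constant functions. $(\cdot,\cdot)$ denotes the integral over $\Omega$ of the product. The pair $(\boldsymbol{\sigma}_h,u_h)\in\mathrm{RT}_0(\mathcal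 T_h)\times P_0(\mathcal T_h)$ is the unique solution of $$(A^{-1}\boldsymbol{\sigma}_h,\boldsymbol{\tau}_h)-(\nabla\cdot\boldsymbol{\tau}_h,u_h)=-(A^{-1}\mathbf f_2,\boldsymbol{\tau}_h)-\langle\boldsymbol{\tau}_h\cdot\mathbf n,g\rangle_{\partial\Omega}\quad\forall\boldsymbol{\tau}_h\in\mathrm{RT}_0(\mathcal T_h),$$ $$(\nabla\cdot\boldsymbol{\sigma}_h,v_h)=(f_1,v_h)\quad\forall v_h\in P_0(\mathcal T_h).$$ The $o(\cdot)$ is understood as $h_{K^{x_0}}\to0$ along the family; the triangle $K_1$ and the field $\mathbf q$ do not depend on the mesh. *)

(* Defs.v *)
From HB Require Import structures.
From mathcomp Require Import all_boot all_order all_algebra.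
From mathcomp Require Import all_classical all_reals all_analysis.

Set Implicit Arguments.
Unset Strict Implicit.
Unset Printing Implicit Defensive.

Import Order.TTheory GRing.Theory Num.Theory.
Import numFieldNormedType.Exports.

Local Open Scope classical_set_scope.
Local Open Scope ring_scope.

(* [plane R] carries the algebra and the topology, [mplane R] (the same type up
   to conversion) the Borel sigma-algebra on which Lebesgue measure lives. *)
Definition plane (R : realType) : Type := (R * R)%type.
Notation mplane R := (measurableTypeR R * measurableTypeR R)%type.

Definition leb2 (R : realType) : {measure set (mplane R) -> \bar R} :=
  (@lebesgue_measure R \x @lebesgue_measure R)%E.

Section Euclidean.
Variable R : realType.
Implicit Types (v w : R * R) (U : set (R * R)).

Definition dot v w : R := v.1 * w.1 + v.2 * w.2.

(* The library norm of [R * R] is the max norm, hence an explicit Euclidean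
   norm and diameter. *)
Definition enorm v : R := Num.sqrt (dot v v).

(* The maximum with 0 gives the empty set diameter 0. *)
Definition ediam U : \bar R :=
  maxe 0%E (ereal_sup [set (enorm (xy.1 - xy.2))%:E | xy in U `*` U]).

Definition colv v : 'cV[R]_2 := \col_i (if i == ord0 then v.1 else v.2).

Definition mxact (M : 'M[R]_2) v : R * R :=
  ((M *m colv v) ord0 ord0, (M *m colv v) ord_max ord0).

Definition bdry U : set (R * R) := closure U `\` interior U.

End Euclidean.

(* One-dimensional Hausdorff measure; in the plane its restriction to a
   rectifiable curve is arc length, with no extra constant. Covers by Borel
   sets suffice, since a set and its closure have the same diameter. *)
Section Hausdorff.
Variable R : realType.
Local Open Scope ereal_scope.

Definition small_diam (d : R) (U : set (mplane R)) : \bar R :=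
  if ediam U <= d%:E then ediam U else +oo.

Definition hausdorff1_delta (d : R) : set (mplane R) -> \bar R :=
  mu_ext (small_diam d).

Definition hausdorff1 (E : set (mplane R)) : \bar R :=
  ereal_sup [set hausdorff1_delta d E | d in [set d : R | (0 < d)%R]].

Lemma ediam_ge0 (U : set (R * R)) : 0 <= ediam U.
Proof. by rewrite /ediam le_max lexx. Qed.

Lemma ediam0 : ediam (set0 : set (R * R)) = 0.
Proof.
by rewrite /ediam set0X image_set0 ereal_sup0; apply/max_idPl; rewrite leNye.
Qed.

Lemma small_diam_ge0 (d : R) U : 0 <= small_diam d U.
Proof. by rewrite /small_diam; case: ifP => _; rewrite ?ediam_ge0 ?leey. Qed.

Lemma small_diam0 (d : R) : (0 < d)%R -> small_diam d set0 = 0.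
Proof. by move=> d0; rewrite /small_diam ediam0 lee_fin ltW. Qed.

Lemma hausdorff1_delta_le (d : R) E : (0 < d)%R ->
  hausdorff1_delta d E <= hausdorff1 E.
Proof. by move=> d0; apply: ereal_sup_ubound; exists d. Qed.

Lemma hausdorff1_ge0 E : 0 <= hausdorff1 E.
Proof.
apply: le_trans (hausdorff1_delta_le E ltr01).
exact/mu_ext_ge0/small_diam_ge0.
Qed.

Lemma hausdorff1_0 : hausdorff1 set0 = 0.
Proof.
apply/eqP; rewrite eq_le hausdorff1_ge0 andbT.
apply: ge_ereal_sup => _ [d d0 <-].
by rewrite /hausdorff1_delta mu_ext0//; [exact: small_diam0|exact: small_diam_ge0].
Qed.

Lemma le_hausdorff1 : {homo hausdorff1 : A B / A `<=` B >-> A <= B}.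
Proof.
move=> A B AB; apply: ge_ereal_sup => _ [d d0 <-].
exact: le_trans (le_mu_ext _ AB) (hausdorff1_delta_le B d0).
Qed.

Lemma hausdorff1_sigma_subadditive : sigma_subadditive hausdorff1.
Proof.
move=> F; apply: ge_ereal_sup => _ [d d0 <-].
apply: le_trans (mu_ext_sigma_subadditive (small_diam_ge0 d) F) _.
apply: lee_nneseries => n _; last exact: hausdorff1_delta_le.
by move=> _; exact/mu_ext_ge0/small_diam_ge0.
Qed.

HB.instance Definition _ := isOuterMeasure.Build R (mplane R) hausdorff1
  hausdorff1_0 hausdorff1_ge0 le_hausdorff1 hausdorff1_sigma_subadditive.

End Hausdorff.

Definition H1 (R : realType) : {outer_measure set (mplane R) -> \bar R} :=
  @hausdorff1 R.

Notation hplane R := (caratheodory_type (H1 R)).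

Definition arclen (R : realType) : {measure set (hplane R) -> \bar R} :=
  (H1 R : set (hplane R) -> \bar R).

Section Lebesgue_spaces.
Variable R : realType.

Definition norm_Lp d (T : measurableType d) (mu : {measure set T -> \bar R})
    (D : set T) (p : \bar R) (f : T -> R) : \bar R :=
  'N[mu]_p[EFin \o (f \_ D)]%E.

Definition in_Lp d (T : measurableType d) (mu : {measure set T -> \bar R})
    (D : set T) (p : \bar R) (f : T -> R) : Prop :=
  measurable_fun D f /\ (norm_Lp mu D p f < +oo)%E.

Definition normv_Lp (D : set (mplane R)) (p : \bar R)
    (F : mplane R -> plane R) : \bar R :=
  norm_Lp (leb2 R) D p (fun x => enorm (F x)).

Definition inv_Lp (D : set (mplane R)) (p : \bar R)
    (F : mplane R -> plane R) : Prop :=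
  [/\ measurable_fun D (fun x => (F x).1), measurable_fun D (fun x => (F x).2)
    & (normv_Lp D p F < +oo)%E].

End Lebesgue_spaces.

Section Domains.
Variable R : realType.
Implicit Types (Om : set (plane R)).

Definition unit_square : set (R * R) := `[0%R, 1%R]%classic `*` `[0%R, 1%R]%classic.

Definition simply_connected Om : Prop :=
  (forall x y, Om x -> Om y -> exists c : R -> R * R,
     [/\ {within `[0%R, 1%R], continuous c}, c 0 = x, c 1 = y
       & forall t, 0 <= t <= 1 -> Om (c t)]) /\
  (forall c : R -> R * R, {within `[0%R, 1%R], continuous c} -> c 0 = c 1 ->
     (forall t, 0 <= t <= 1 -> Om (c t)) ->
     exists H : R * R -> R * R,
       [/\ {within unit_square, continuous H},
           forall z, unit_square z -> Om (H z),
           forall t, 0 <= t <= 1 -> H (0, t) = c t /\ H (1, t) = c 0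
         & forall s, 0 <= s <= 1 -> H (s, 0) = c 0 /\ H (s, 1) = c 0]).

(* Near each boundary point, in a rotated frame (c, s) = (cos, sin) centred
   there, [Om] is the part of a rectangle above a Lipschitz graph. *)
Definition lipschitz_boundary Om : Prop :=
  forall z, bdry Om z -> exists (c s r d L : R) (gam : R -> R),
    [/\ c ^+ 2 + s ^+ 2 = 1, 0 < r /\ 0 < d, gam 0 = 0,
        forall a b, `|gam a - gam b| <= L * `|a - b|
      & forall a b, `|a| < r -> `|b| < d ->
          Om (z.1 + c * a - s * b, z.2 + s * a + c * b) <-> gam a < b].

Definition bounded_sc_lipschitz_domain Om : Prop :=
  [/\ open (Om : set (R * R)), connected (Om : set (R * R)), Om !=set0,
      bounded_set (Om : set (R * R))
    & simply_connected Om /\ lipschitz_boundary Om].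

End Domains.

Section Sobolev.
Variables (R : realType) (Om : set (mplane R)).
Implicit Types (phi u w : R * R -> R) (G tau : R * R -> R * R).

Definition dir (b : bool) : R * R := if b then (0, 1) else (1, 0).

Definition iter_partial (s : seq bool) phi : R * R -> R :=
  foldr (fun b f => 'D_(dir b) f) phi s.

Definition smooth phi : Prop := forall s,
  continuous (iter_partial s phi) /\
  forall b x, derivable (iter_partial s phi) x (dir b).

Definition test_function phi : Prop :=
  smooth phi /\ exists K : set (R * R),
    [/\ compact K, K `<=` Om & forall x, ~ K x -> phi x = 0].

Definition grad phi (x : R * R) : R * R :=
  ('D_(dir false) phi x, 'D_(dir true) phi x).

Definition weak_grad u G : Prop := forall phi, test_function phi ->
  \int[leb2 R]_(x in Om) (u x * (grad phi x).1) =
    - (\int[leb2 R]_(x in Om) ((G x).1 * phi x)) /\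
  \int[leb2 R]_(x in Om) (u x * (grad phi x).2) =
    - (\int[leb2 R]_(x in Om) ((G x).2 * phi x)).

Definition in_W1p (p : R) u G : Prop :=
  [/\ in_Lp (leb2 R) Om p%:E u, inv_Lp Om p%:E G & weak_grad u G].

(* The trace operator is the continuous extension to W^{1,p} of the restriction
   to the boundary of functions smooth up to the boundary. *)
Definition has_trace (p : R) u G (g : hplane R -> R) : Prop :=
  in_Lp (arclen R) (bdry Om) p%:E g /\
  exists w : nat -> R * R -> R,
    [/\ forall n, smooth (w n),
        norm_Lp (leb2 R) Om p%:E (fun x => w n x - u x) @[n --> \oo] --> 0%E,
        normv_Lp Om p%:E (fun x => grad (w n) x - G x) @[n --> \oo] --> 0%E
      & norm_Lp (arclen R) (bdry Om) p%:E (fun x => w n x - g x)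
          @[n --> \oo] --> 0%E].

(* Sobolev-Slobodeckij space on the (one-dimensional) boundary. *)
Definition in_Wsp_bdry (s p : R) (g : hplane R -> R) : Prop :=
  in_Lp (arclen R) (bdry Om) p%:E g /\
  (\int[arclen R]_(x in bdry Om) \int[arclen R]_(y in bdry Om)
     (`|g x - g y| `^ p /
        enorm ((x : R * R) - (y : R * R)) `^ (1 + s * p))%:E < +oo)%E.

Definition is_div tau (d : R * R -> R) : Prop :=
  in_Lp (leb2 R) Om 2%:E d /\
  forall phi, test_function phi ->
    \int[leb2 R]_(x in Om) dot (tau x) (grad phi x) =
      - (\int[leb2 R]_(x in Om) (d x * phi x)).

Definition in_Hdiv tau : Prop := inv_Lp Om 2%:E tau /\ exists d, is_div tau d.

End Sobolev.

Section Continuous_problem.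
Variables (R : realType) (Om : set (mplane R)) (p : R).
Variables (A : R * R -> 'M[R]_2) (x0 : R * R).

Definition elliptic_matrix (alpha beta : R) : Prop :=
  (forall i j, in_Lp (leb2 R) Om +oo%E (fun x => A x i j)) /\
  {ae leb2 R, forall x, Om x -> (A x)^T = A x /\
    forall xi : R * R,
      alpha * enorm xi ^+ 2 <= dot xi (mxact (A x) xi) <= beta * enorm xi ^+ 2}.

Definition is_weak_solution (f1 : R * R -> R) (g : hplane R -> R)
    (u : R * R -> R) (G : R * R -> R * R) : Prop :=
  [/\ in_W1p Om p u G,
      forall phi, test_function Om phi ->
        \int[leb2 R]_(x in Om) dot (mxact (A x) (G x)) (grad phi x) =
          \int[leb2 R]_(x in Om) (f1 x * phi x) + phi x0
    & has_trace Om p u G g].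

Definition is_unique_weak_solution (f1 : R * R -> R) (g : hplane R -> R)
    (u : R * R -> R) (G : R * R -> R * R) : Prop :=
  is_weak_solution f1 g u G /\
  forall u' G', is_weak_solution f1 g u' G' ->
    {ae leb2 R, forall x, Om x -> u' x = u x}.

Definition f2 (x : R * R) : R * R :=
  ((2 * pi)^-1 / enorm (x - x0) ^+ 2) *: (x - x0).

Definition modified_flux (G : R * R -> R * R) (x : R * R) : R * R :=
  - mxact (A x) (G x) - f2 x.

End Continuous_problem.

(* A triangle is the tuple of its vertices. As elements of a mesh, triangles
   are open sets. *)
Notation triangle R := (3.-tuple (R * R)%type).

Section Meshes.
Variable R : realType.
Implicit Types (K L : triangle R) (T : seq (triangle R)) (Om : set (mplane R)).

Definition barycenter K (l : 'I_3 -> R) : R * R := \sum_(i < 3) l i *: tnth K i.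

Definition open_tri K : set (R * R) :=
  [set x | exists l, [/\ forall i, 0 < l i, \sum_i l i = 1 & x = barycenter K l]].

Definition face K (S : {set 'I_3}) : set (R * R) :=
  [set x | exists l, [/\ forall i, 0 <= l i, forall i, i \notin S -> l i = 0,
    \sum_i l i = 1 & x = barycenter K l]].

Definition closed_tri K : set (R * R) := face K [set: 'I_3].

Definition proper_triangle K : Prop :=
  let v i := tnth K (inord i) in
  ((v 1%N).1 - (v 0%N).1) * ((v 2%N).2 - (v 0%N).2) -
  ((v 1%N).2 - (v 0%N).2) * ((v 2%N).1 - (v 0%N).1) != 0.

Definition triangulation Om T : Prop :=
  [/\ uniq T,
      forall K, K \in T -> proper_triangle K /\ open_tri K `<=` Om,
      closure (Om : set (R * R)) = \bigcup_(K in [set` T]) closed_tri K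
    & forall K L, K \in T -> L \in T -> K != L ->
        open_tri K `&` open_tri L = set0 /\
        exists S S' : {set 'I_3},
          closed_tri K `&` closed_tri L = face K S /\
          closed_tri K `&` closed_tri L = face L S'].

(* Each element contains a disc of radius at least diameter / kappa. *)
Definition shape_regular (I : Type) (T : I -> seq (triangle R)) : Prop :=
  exists2 kappa : R, 0 < kappa & forall i K, K \in T i ->
    exists (z : R * R) (r : R),
      [/\ 0 < r, [set x | enorm (x - z) < r] `<=` open_tri K
        & (ediam (open_tri K) <= (kappa * r)%:E)%E].

Definition in_RT0 Om T (tau : R * R -> R * R) : Prop :=
  in_Hdiv Om tau /\ forall K, K \in T -> exists (a : R * R) (b : R),
    forall x, open_tri K x -> tau x = a + b *: x.

(* Measurability only constrains [v] on the edges of the mesh. *)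
Definition in_P0 Om T (v : R * R -> R) : Prop :=
  measurable_fun Om (v : mplane R -> R) /\
  forall K, K \in T -> exists c : R, forall x, open_tri K x -> v x = c.

Definition edge K (i : 'I_3) : set (R * R) := face K [set~ i].

(* Unit normal to [edge K i] pointing away from the opposite vertex [i]. *)
Definition unit_normal K (i : 'I_3) : R * R :=
  let a := tnth K (ordS i) in
  let b := tnth K (ordS (ordS i)) in
  let n : R * R := (b.2 - a.2, a.1 - b.1) in
  (Num.sg (dot n (a - tnth K i)) / enorm n) *: n.

(* The restriction to [K] of a Raviart-Thomas field, extended to the closure by
   its polynomial expression. *)
Definition RT_ext K (tau : R * R -> R * R) (x : R * R) : R * R :=
  let ab := xget (0, 0) [set ab : (R * R) * R |
              forall y, open_tri K y -> tau y = ab.1 + ab.2 *: y] in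
  ab.1 + ab.2 *: x.

Definition normal_pairing Om T (tau : R * R -> R * R) (g : hplane R -> R) : R :=
  \sum_(K <- T) \sum_(i < 3 | `[< edge K i `<=` bdry Om >])
    \int[arclen R]_(x in edge K i) (dot (RT_ext K tau x) (unit_normal K i) * g x).

Definition is_discrete_solution Om T (A : R * R -> 'M[R]_2) (x0 : R * R)
    (f1 : R * R -> R) (g : hplane R -> R)
    (sigmah : R * R -> R * R) (uh : R * R -> R) : Prop :=
  [/\ in_RT0 Om T sigmah, in_P0 Om T uh,
      forall tau d, in_RT0 Om T tau -> is_div Om tau d ->
        \int[leb2 R]_(x in Om) dot (mxact (invmx (A x)) (sigmah x)) (tau x) -
        \int[leb2 R]_(x in Om) (d x * uh x) =
        - (\int[leb2 R]_(x in Om) dot (mxact (invmx (A x)) (f2 x0 x)) (tau x)) -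
        normal_pairing Om T tau g
    & forall d v, is_div Om sigmah d -> in_P0 Om T v ->
        \int[leb2 R]_(x in Om) (d x * v x) = \int[leb2 R]_(x in Om) (f1 x * v x)].

Definition is_unique_discrete_solution Om T (A : R * R -> 'M[R]_2) (x0 : R * R)
    (f1 : R * R -> R) (g : hplane R -> R)
    (sigmah : R * R -> R * R) (uh : R * R -> R) : Prop :=
  is_discrete_solution Om T A x0 f1 g sigmah uh /\
  forall sigmah' uh', is_discrete_solution Om T A x0 f1 g sigmah' uh' ->
    {ae leb2 R, forall x, Om x -> sigmah' x = sigmah x /\ uh' x = uh x}.

End Meshes.

(* Main.v *)
Require Import Defs.
From HB Require Import structures.
From mathcomp Require Import all_boot all_order all_algebra.
From mathcomp Require Import all_classical all_reals all_analysis.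
From mathcomp Require Import measurable_realfun.
From mathcomp Require Import ring lra.

Set Implicit Arguments.
Unset Strict Implicit.
Unset Printing Implicit Defensive.

Import Order.TTheory GRing.Theory Num.Theory.
Import numFieldNormedType.Exports.

Local Open Scope classical_set_scope.
Local Open Scope ring_scope.

(** Why the theorem holds.  On an element [K] that is star-shaped with respect to
[x0], let [F = q - tau] with [tau] a Raviart-Thomas field, which on [K] reads
[tau x = a' + b *: (x - x0)].  Zooming towards [x0], and using that [q] is
homogeneous of degree -1,

    [t *: F (x0 + t *: (x - x0)) = q x - t *: a' - t ^+ 2 * b *: (x - x0)].

For almost every [x] the right-hand side is a quadratic polynomial in [t] whose
value at [t = 0] is [q x].  Lagrange interpolation at the nodes 1, 1/2, 1/4 recovers [q x]
with the weights 1/3, -2, 8/3, so [q] is a fixed linear combination of three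
zooms of [F].  A zoom only looks at [F] inside [K] and costs a power of [t] in
the L^p norm ([normv_Lp_zoom]).  Hence the L^p norm of [q] on [K] is at most a
constant depending only on [p] times that of [q - tau], uniformly in [tau]
([homogeneous_RT_distance]).

The same scaling shows that the norm of [q] on the element of size [h] equals
[h `^ (2 / p - 1)] times a positive constant ([normv_Lp_homogeneous]).  The
remainder [sigma - q] is of lower order than this, so it is absorbed by the
triangle inequality, and the norm over the domain dominates the norm over the
element.

The measure-theoretic input is the scaling of planar Lebesgue measure under
dilations ([leb2_dilate]); the geometric input is that an open triangle is stable
under contractions towards a point of its closure ([open_tri_star]). *)

(** * Borel sets of the plane and dilations *)

(** The plane has a countable base made of squares with rational centres and
rational sizes, and such squares generate the product sigma-algebra. *)
Lemma plane_open_measurable (R : realType) (U : set (R * R)) :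
  open U -> measurable (U : set (mplane R)).
Proof.
move=> oU.
pose box (a b r : R) : set (mplane R) := ball a r `*` ball b r.
pose F (a b r : rat) : set (mplane R) :=
  if `[< box (ratr a) (ratr b) (ratr r) `<=` U >]
  then box (ratr a) (ratr b) (ratr r) else set0.
suff -> : U = \bigcup_a \bigcup_b \bigcup_r F a b r.
  apply: bigcupT_measurable_rat => a; apply: bigcupT_measurable_rat => b.
  apply: bigcupT_measurable_rat => r; rewrite /F; case: ifPn => // _.
  by apply: measurableX; exact: measurable_ball.
rewrite eqEsubset; split => [x Ux|x [a _ [b _ [r _]]]]; last first.
  by rewrite /F; case: ifPn => // /asboolP abrU /abrU.
have /nbhs_ballP[e /= e0 xeU] : nbhs x U by exact: open_nbhs_nbhs.
have e20 : 0 < e / 2 by rewrite divr_gt0.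
have /rat_in_itvoo[r /itvP rr] : 0 < e / 2 by [].
have r0 : 0 < ratr r :> R by rewrite rr.
have near (y : R) : exists a : rat, `|y - ratr a| < ratr r.
  have /rat_in_itvoo[a /itvP aa] : y - ratr r < y + ratr r by lra.
  by exists a; rewrite ltr_distlC !aa.
have [a ax] := near x.1; have [b bx] := near x.2.
exists a => //; exists b => //; exists r => //; rewrite /F.
case: ifPn => [_|/asboolPn abrU]; first by split; rewrite /ball/= distrC.
exfalso; apply: abrU => y [/= y1 y2]; apply: xeU.

have re : ratr r + ratr r < e by rewrite [e]splitr ltrD ?rr.
by split => /=; rewrite /ball/=; [move: y1 ax|move: y2 bx];
  rewrite /ball/= !ltr_norml => /andP[? ?] /andP[? ?]; apply/andP; split; lra.
Qed.

Section dilation.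
Variable R : realType.

Definition dilate (c : R * R) (t : R) (x : R * R) : R * R := c + t *: (x - c).

Lemma dilateE c t x :
  dilate c t x = (c.1 + t * (x.1 - c.1), c.2 + t * (x.2 - c.2)).
Proof. by []. Qed.

Lemma dilateM c s t x : dilate c s (dilate c t x) = dilate c (s * t) x.
Proof. by rewrite !dilateE; congr pair => /=; ring. Qed.

Lemma dilate1 c x : dilate c 1 x = x.
Proof. by rewrite /dilate scale1r addrC subrK. Qed.

Local Notation mu := (@lebesgue_measure R).

Lemma measurable_dilate c t :
  measurable_fun setT (dilate c t : mplane R -> mplane R).
Proof.
apply: measurable_fun_pair; apply: measurable_funD => //;
  apply: measurable_funM => //; apply: measurable_funB => //.
Qed.

(** By uniqueness of Lebesgue measure, it is enough to compare the two sides on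
half-open intervals, where the claim is the scaling of lengths. *)
Lemma lebesgue_measure_dilate (c t : R) (A : set (measurableTypeR R)) :
  0 < t -> measurable A ->
  (mu A = t%:E * mu [set y | A (c + t * (y - c))%R])%E.
Proof.
move=> t0 mA.
pose f : measurableTypeR R -> measurableTypeR R := fun y => c + t * (y - c).
have mf : measurable_fun setT f.
  apply: measurable_funD => //; apply: measurable_funM => //.
  exact: measurable_funB.
have [m1 m1E] : exists m1 : {measure set (measurableTypeR R) -> \bar R},
    forall B, m1 B = (t%:E * mu (f @^-1` B))%E.
  by unshelve eexists (mscale (NngNum (ltW t0))
    (pushforward mu f : {measure set (measurableTypeR R) -> \bar R})).
rewrite -[RHS]m1E; apply: lebesgue_measure_unique => //= _ [[a b]] _ <-.
rewrite m1E.
have -> : f @^-1` `]a, b]%classic = `]c + (a - c) / t, c + (b - c) / t]%classic.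
  apply/funext => y; rewrite /= !in_itv/= /f; congr (is_true (_ && _)).
    by rewrite -[RHS]ltrBrDl ltr_pdivrMr// ltrBlDl [(y - c) * t]mulrC.
  by rewrite -[RHS]lerBlDl ler_pdivlMr// lerBrDl [(y - c) * t]mulrC.
rewrite !lebesgue_measure_itv/= !lte_fin ltrD2l ltr_pM2r ?invr_gt0// ltrD2r.
case: ifPn => _; last by rewrite mule0.
by rewrite -EFinB -EFinM; congr EFin; field; rewrite gt_eqF.
Qed.

(** A dilation of the plane is a product of two dilations of the line, so both
sides agree on rectangles, which determine the product measure. *)
Lemma leb2_dilate (c : R * R) (t : R) (A : set (mplane R)) :
  0 < t -> measurable A ->
  (leb2 R A = (t ^+ 2)%:E * leb2 R (dilate c t @^-1` A))%E.
Proof.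
move=> t0 mA; have mf := measurable_dilate c t.
pose f : mplane R -> mplane R := dilate c t.
have [m1 m1E] : exists m1 : {measure set (mplane R) -> \bar R},
    forall B, m1 B = ((t ^+ 2)%:E * leb2 R (f @^-1` B))%E.
  by unshelve eexists (mscale (NngNum (sqr_ge0 t))
    (pushforward (leb2 R) f : {measure set (mplane R) -> \bar R})).
rewrite -[RHS]m1E; apply: product_measure_unique => // X Y mX mY.
rewrite m1E [X in leb2 R X](_ : _ =
    [set y | X (c.1 + t * (y - c.1))] `*` [set y | Y (c.2 + t * (y - c.2))])//.
have mg (a : R) (Z : set (measurableTypeR R)) : measurable Z ->
    measurable ([set y | Z (a + t * (y - a))] : set (measurableTypeR R)).
  move=> mZ; have mh : measurable_fun setT (fun y : R => a + t * (y - a)).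
    apply: measurable_funD => //; apply: measurable_funM => //.
    exact: measurable_funB.
  by have := mh measurableT _ mZ; rewrite setTI.
rewrite [leb2 R _](product_measure1E mu mu (mg c.1 X mX) (mg c.2 Y mY)).
transitivity (mu X * mu Y)%E => //.
rewrite (lebesgue_measure_dilate c.1 t0 mX) (lebesgue_measure_dilate c.2 t0 mY).
by rewrite muleACA -EFinM expr2.
Qed.

Lemma ge0_integral_dilate (c : R * R) (t : R) (D : set (mplane R))
    (g : mplane R -> \bar R) : 0 < t -> measurable D -> measurable_fun D g ->
  (forall x, D x -> 0 <= g x)%E ->
  (\int[leb2 R]_(x in D) g x =
   (t ^+ 2)%:E * \int[leb2 R]_(x in dilate c t @^-1` D) g (dilate c t x))%E.
Proof.
move=> t0 mD mg g0; have mf := measurable_dilate c t.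
rewrite -(ge0_integral_pushforward mf)//=; last by move=> x /[!inE]; exact: g0.
rewrite -(ge0_integral_mscale _ mD (NngNum (sqr_ge0 t)) mg)//.
by apply: eq_measure_integral => /= A mA _; exact: leb2_dilate.
Qed.

End dilation.

(** * Lebesgue norms over a subset *)

Section norm_Lp.
Context d (T : measurableType d) (R : realType).
Variables (mu : {measure set T -> \bar R}) (p : R).
Hypothesis p1 : 1 <= p.
Implicit Types (D : set T) (f g : T -> R).
Local Open Scope ereal_scope.

Let p0 : (0 < p)%R := lt_le_trans ltr01 p1.

Lemma norm_LpE D f :
  norm_Lp mu D p%:E f = (\int[mu]_(x in D) (`|f x| `^ p)%:E) `^ p^-1.
Proof.
rewrite /norm_Lp unlock; congr poweR.
rewrite [RHS]integral_mkcond; apply: eq_integral => x _.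
rewrite /= !patchE/=; case: ifPn => // _.
by rewrite normr0 powR0// gt_eqF.
Qed.

Lemma norm_Lp_ge0 D f : 0 <= norm_Lp mu D p%:E f.
Proof. exact: Lnorm_ge0. Qed.

Lemma measurable_powR_norm D f : measurable_fun D f ->
  measurable_fun D (fun x => (`|f x| `^ p)%:E).
Proof.
move=> mf; apply/measurable_EFinP.
apply: (measurableT_comp (measurable_powR p)) => //.
exact: measurableT_comp mf.
Qed.

(** Comparing norms through a pointwise inequality almost everywhere serves both
for the triangle inequality of fields and for replacing a field by one that is
equal to it almost everywhere. *)
Lemma norm_Lp_le_ae D f g : measurable D ->
  measurable_fun D f -> measurable_fun D g ->
  {ae mu, forall x, D x -> (`|f x| <= `|g x|)%R} ->
  norm_Lp mu D p%:E f <= norm_Lp mu D p%:E g.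
Proof.
move=> mD mf mg fg; rewrite !norm_LpE; apply: gt0_ler_poweR.
- by rewrite invr_ge0 ltW.
- by rewrite in_itv/= leey andbT integral_ge0// => x _; rewrite lee_fin powR_ge0.
- by rewrite in_itv/= leey andbT integral_ge0// => x _; rewrite lee_fin powR_ge0.
apply: ae_ge0_le_integral => //; try by move=> x _; rewrite lee_fin powR_ge0.
- exact: measurable_powR_norm.
- exact: measurable_powR_norm.
apply: filterS fg => x /[apply] fg.
by rewrite lee_fin ge0_ler_powR// ?nnegrE// ltW.
Qed.

Lemma norm_LpS D E f : measurable D -> measurable E -> measurable_fun E f ->
  D `<=` E -> norm_Lp mu D p%:E f <= norm_Lp mu E p%:E f.
Proof.
move=> mD mE mf DE; rewrite !norm_LpE; apply: gt0_ler_poweR.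
- by rewrite invr_ge0 ltW.
- by rewrite in_itv/= leey andbT integral_ge0// => x _; rewrite lee_fin powR_ge0.
- by rewrite in_itv/= leey andbT integral_ge0// => x _; rewrite lee_fin powR_ge0.
by apply: ge0_subset_integral => //; exact: measurable_powR_norm.
Qed.

Lemma norm_LpZ D f (k : R) : measurable D -> measurable_fun D f ->
  norm_Lp mu D p%:E (fun x => k * f x)%R = `|k|%:E * norm_Lp mu D p%:E f.
Proof.
move=> mD mf; rewrite !norm_LpE.
under eq_integral do rewrite normrM powRM// EFinM.
rewrite ge0_integralZl_EFin ?powR_ge0//; last exact: measurable_powR_norm.
rewrite poweRM ?lee_fin ?powR_ge0//; last first.
  by apply: integral_ge0 => x _; rewrite lee_fin powR_ge0.
by rewrite poweR_EFin -powRrM mulfV ?gt_eqF// powRr1.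
Qed.

Lemma norm_LpD D f g : measurable D -> measurable_fun D f ->
  measurable_fun D g ->
  norm_Lp mu D p%:E (f \+ g)%R <= norm_Lp mu D p%:E f + norm_Lp mu D p%:E g.
Proof.
move=> mD mf mg; rewrite /norm_Lp.
have -> : EFin \o (f \+ g)%R \_ D = EFin \o ((f \_ D) \+ (g \_ D))%R.
  by apply/funext => x /=; rewrite !patchE; case: ifPn; rewrite ?addr0.
by apply: minkowski_EFin => //; exact/(measurable_restrictT _ mD).
Qed.

Lemma norm_Lp_eq0 D f : measurable D -> measurable_fun D f ->
  norm_Lp mu D p%:E f = 0 -> {ae mu, forall x, D x -> f x = 0%R}.
Proof.
move=> mD mf; rewrite /norm_Lp => /Lnorm_eq0_eq0 h.
have /h : measurable_fun setT (EFin \o f \_ D).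
  exact/measurable_EFinP/(measurable_restrictT _ mD).
rewrite lte_fin => /(_ p0); apply: filterS => x /= /(_ I) + Dx.
by rewrite patchE mem_set// => -[].
Qed.

End norm_Lp.

(** * Lebesgue norms of planar vector fields *)

Section euclidean_norm.
Variable R : realType.
Implicit Types v w : R * R.

Lemma enorm_ge0 v : 0 <= enorm v.
Proof. exact: sqrtr_ge0. Qed.

Lemma enormZ (k : R) v : enorm (k *: v) = `|k| * enorm v.
Proof.
rewrite /enorm -sqrtr_sqr -sqrtrM ?sqr_ge0//; congr Num.sqrt.
by rewrite /dot/= /GRing.scale/=; ring.
Qed.

Lemma enorm_eq0 v : enorm v = 0 -> v = 0.
Proof.
move=> /eqP; rewrite sqrtr_eq0 /dot => h.
have h1 : v.1 ^+ 2 = 0 by have := sqr_ge0 v.1; have := sqr_ge0 v.2; nra.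
have h2 : v.2 ^+ 2 = 0 by have := sqr_ge0 v.1; have := sqr_ge0 v.2; nra.
move/eqP: h1; rewrite sqrf_eq0 => /eqP h1.
move/eqP: h2; rewrite sqrf_eq0 => /eqP h2.
by rewrite [v]surjective_pairing h1 h2.
Qed.

(** The inequality reduces to Cauchy-Schwarz, which in the plane is Lagrange's
identity: the defect is the square of the cross product. *)
Lemma ler_enormD v w : enorm (v + w) <= enorm v + enorm w.
Proof.
have dot_ge0 u : 0 <= dot u u :> R by rewrite /dot -!expr2 addr_ge0 ?sqr_ge0.
have enorm2 u : enorm u ^+ 2 = dot u u :> R by rewrite sqr_sqrtr.
rewrite -(@ler_pXn2r _ 2)// ?nnegrE ?addr_ge0 ?enorm_ge0//.
rewrite sqrrD !enorm2.
have -> : dot (v + w) (v + w) = dot v v + dot v w *+ 2 + dot w w.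
  by rewrite /dot/=; ring.
rewrite lerD2r lerD2l ler_pMn2r//; apply: le_trans (ler_norm _) _.
rewrite -sqrtr_sqr -sqrtrM// ler_wsqrtr// -subr_ge0.
have -> : dot v v * dot w w - dot v w ^+ 2 = (v.1 * w.2 - v.2 * w.1) ^+ 2.
  by rewrite /dot; ring.
exact: sqr_ge0.
Qed.

End euclidean_norm.

Section measurable_field.
Variable R : realType.
Implicit Types (D E : set (mplane R)) (F G : mplane R -> plane R).

Definition measurable_field D F : Prop :=
  measurable_fun D (fun x => (F x).1) /\ measurable_fun D (fun x => (F x).2).

Lemma measurable_fieldS D E F : measurable E -> D `<=` E ->
  measurable_field E F -> measurable_field D F.
Proof. by move=> mE DE [F1 F2]; split; exact: (measurable_funS mE DE). Qed.

Lemma measurable_fieldD D F G : measurable_field D F -> measurable_field D G ->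
  measurable_field D (fun x => F x + G x).
Proof. by move=> [F1 F2] [G1 G2]; split; exact: measurable_funD. Qed.

Lemma measurable_fieldB D F G : measurable_field D F -> measurable_field D G ->
  measurable_field D (fun x => F x - G x).
Proof. by move=> [F1 F2] [G1 G2]; split; exact: measurable_funB. Qed.

Lemma measurable_fieldZ D (k : mplane R -> R) F : measurable_fun D k ->
  measurable_field D F -> measurable_field D (fun x => k x *: F x).
Proof. by move=> mk [F1 F2]; split; exact: measurable_funM. Qed.

Lemma measurable_field_cst D (v : R * R) : measurable_field D (fun=> v).
Proof. by split; exact: measurable_cst. Qed.

Lemma measurable_field_id D : measurable_field D (fun x => x).
Proof.
by split; apply: measurable_funTS; [exact: measurable_fst|exact: measurable_snd].
Qed.

Lemma measurable_field_comp D F (f : mplane R -> mplane R) :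
  measurable D -> measurable_fun setT f -> measurable_field D F ->
  measurable_field (f @^-1` D) (fun x => F (f x)).
Proof.
move=> mD mf [F1 F2].
have mfD : measurable_fun (f @^-1` D) f by exact: measurable_funTS.
have fD : f @` (f @^-1` D) `<=` D by move=> _ [x Dx <-].
split; first exact: measurable_comp mD fD F1 mfD.
exact: measurable_comp mD fD F2 mfD.
Qed.

Lemma measurable_enorm D F :
  measurable_field D F -> measurable_fun D (fun x => enorm (F x)).
Proof.
move=> [F1 F2].
apply: (@measurableT_comp _ _ _ _ _ _ (@Num.sqrt R)).
  exact: continuous_measurable_fun (@sqrt_continuous R).
by apply: measurable_funD; exact: measurable_funM.
Qed.

Variables (p : R).
Hypothesis p1 : 1 <= p.

Let p0 : (0 < p)%R := lt_le_trans ltr01 p1.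

Lemma normv_Lp_ge0 D F : (0 <= normv_Lp D p%:E F)%E.
Proof. exact: norm_Lp_ge0. Qed.

Lemma eq_normv_Lp_ae D F G : measurable D ->
  measurable_field D F -> measurable_field D G ->
  {ae leb2 R, forall x, D x -> F x = G x} ->
  normv_Lp D p%:E F = normv_Lp D p%:E G.
Proof.
move=> mD mF mG FG; apply/eqP; rewrite eq_le; apply/andP; split.
  apply: norm_Lp_le_ae => //; [exact: measurable_enorm..|].
  by apply: filterS FG => x /[apply] ->.
apply: norm_Lp_le_ae => //; [exact: measurable_enorm..|].
by apply: filterS FG => x /[apply] ->.
Qed.

Lemma normv_LpS D E F : measurable D -> measurable E -> measurable_field E F ->
  D `<=` E -> (normv_Lp D p%:E F <= normv_Lp E p%:E F)%E.
Proof. by move=> mD mE mF; apply: norm_LpS => //; exact: measurable_enorm. Qed.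

Lemma normv_LpZ D F (k : R) : measurable D -> measurable_field D F ->
  normv_Lp D p%:E (fun x => k *: F x) = (`|k|%:E * normv_Lp D p%:E F)%E.
Proof.
move=> mD mF; rewrite /normv_Lp -[`|k|]normr_id -norm_LpZ//; last first.
  exact: measurable_enorm.
by congr norm_Lp; apply/funext => x; rewrite enormZ.
Qed.

Lemma normv_LpD D F G : measurable D -> measurable_field D F ->
  measurable_field D G ->
  (normv_Lp D p%:E (fun x => F x + G x)%R <=
   normv_Lp D p%:E F + normv_Lp D p%:E G)%E.
Proof.
move=> mD mF mG.
apply: (@le_trans _ _ (norm_Lp (leb2 R) D p%:E
    ((fun x => enorm (F x)) \+ (fun x => enorm (G x))))); last first.
  by apply: norm_LpD => //; exact: measurable_enorm.
apply: norm_Lp_le_ae => //.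
- by apply: measurable_enorm; exact: measurable_fieldD.
- by apply: measurable_funD; exact: measurable_enorm.
- apply: aeW => x _; rewrite !ger0_norm ?addr_ge0 ?enorm_ge0//.
  exact: ler_enormD.
Qed.

Lemma normv_Lp_eq0 D F : measurable D -> measurable_field D F ->
  normv_Lp D p%:E F = 0%E -> {ae leb2 R, forall x, D x -> F x = 0}.
Proof.
move=> mD mF /(norm_Lp_eq0 p1 mD (measurable_enorm mF)).
by apply: filterS => x /[apply]/enorm_eq0.
Qed.

(** The Jacobian [t ^+ 2] of the dilation becomes [t `^ (2 / p)] under the p-th
root. *)
Lemma normv_Lp_dilate (c : R * R) (t : R) D F : 0 < t -> measurable D ->
  measurable_field D F ->
  (normv_Lp D p%:E F = (t `^ (2 / p))%:E *
    normv_Lp (dilate c t @^-1` D) p%:E (fun x => F (dilate c t x)))%E.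
Proof.
move=> t0 mD mF; rewrite /normv_Lp !norm_LpE//.
rewrite (ge0_integral_dilate c t0 mD)//.
- rewrite poweRM ?lee_fin ?sqr_ge0//; last first.
    by apply: integral_ge0 => x _; rewrite lee_fin powR_ge0.
  by rewrite poweR_EFin powRrM powR_mulrn ?ltW.
- by apply: measurable_powR_norm; exact: measurable_enorm.
Qed.

End measurable_field.

(** * Fields homogeneous of degree -1 against Raviart-Thomas fields *)

Section homogeneous_field.
Variables (R : realType) (p : R) (c : R * R) (K : set (mplane R)).
Hypothesis p1 : 1 <= p.
Hypothesis mK : measurable K.
Hypothesis starK : forall t x, 0 < t -> t <= 1 -> K x -> K (dilate c t x).

(** [F \o dilate c t] on [K] only sees [F] on the contracted copy of [K], which
lies inside [K] by star-shapedness; the exponent collects the factor [t] and the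
Jacobian. *)
Lemma normv_Lp_zoom (F : mplane R -> plane R) (t : R) :
  measurable_field K F -> 0 < t -> t <= 1 ->
  (normv_Lp K p%:E (fun x => t *: F (dilate c t x)) <=
   (t `^ (1 - 2 / p))%:E * normv_Lp K p%:E F)%E.
Proof.
move=> mF t0 t1.
pose S : set (mplane R) := dilate c t^-1 @^-1` K.
have mS : measurable S by rewrite -[S]setTI; exact: measurable_dilate.
have SK : S `<=` K.
  move=> x /(starK t0 t1); rewrite dilateM divff ?gt_eqF// dilate1.
  by [].
have KE : dilate c t @^-1` S = K.
  by apply/funext => x; rewrite /S/= dilateM mulVf ?gt_eqF// dilate1.
have mFS : measurable_field S F by exact: measurable_fieldS SK mF.
have := normv_Lp_dilate p1 c t0 mS mFS; rewrite KE => E.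
have mFt : measurable_field K (fun x => F (dilate c t x)).
  by rewrite -KE; apply: measurable_field_comp => //; exact: measurable_dilate.
rewrite normv_LpZ// gtr0_norm//.
have -> : (t%:E * normv_Lp K p%:E (fun x => F (dilate c t x)) =
    (t `^ (1 - 2 / p))%:E * normv_Lp S p%:E F)%E.
  rewrite E muleA -EFinM -powRD ?subrK ?powRr1 ?ltW//.
  by rewrite gt_eqF ?implybT.
by rewrite lee_wpmul2l ?lee_fin ?powR_ge0//; exact: normv_LpS.
Qed.

(** The weights 1/3, 2, 8/3 are the absolute values of the Lagrange coefficients at
0 for the nodes 1, 1/2, 1/4; each is multiplied by the cost of zooming to its
node. *)
Definition zoom_cst : R :=
  3^-1 + 2 * 2^-1 `^ (1 - 2 / p) + 8 / 3 * 4^-1 `^ (1 - 2 / p).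

Lemma zoom_cst_gt0 : 0 < zoom_cst.
Proof. by rewrite /zoom_cst !addr_gt0 ?mulr_gt0 ?powR_gt0 ?divr_gt0 ?invr_gt0. Qed.

(** With [F] the difference on the right, [t *: F (dilate c t x)] is for almost
every [x] quadratic in [t] with constant term [q x], and three values determine a
quadratic polynomial. The coefficients of degree 1 and 2 carry [a] and [b], which
is why the bound is uniform in them. *)
Lemma homogeneous_RT_distance (q : mplane R -> plane R) (a : R * R) (b : R) :
  measurable_field K q ->
  (forall t, 0 < t -> t <= 1 ->
    {ae leb2 R, forall x, K x -> q (dilate c t x) = t^-1 *: q x}) ->
  (normv_Lp K p%:E q <=
   zoom_cst%:E * normv_Lp K p%:E (fun x => q x - (a + b *: x))%R)%E.
Proof.
move=> mq hq.
pose F : mplane R -> plane R := fun x => q x - (a + b *: x).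
have mF : measurable_field K F.
  apply: measurable_fieldB => //; apply: measurable_fieldD.
    exact: measurable_field_cst.
  by apply: measurable_fieldZ => //; exact: measurable_field_id.
pose Z (t : R) : mplane R -> plane R := fun x => t *: F (dilate c t x).
have mZ t : 0 < t -> t <= 1 -> measurable_field K (Z t).
  move=> t0 t1; apply: measurable_fieldZ => //.
  apply: (@measurable_fieldS _ _ (dilate c t @^-1` K)).
  - by rewrite -[X in measurable X]setTI; exact: measurable_dilate.
  - by move=> x; exact: starK.
  - by apply: measurable_field_comp => //; exact: measurable_dilate.
have half : 0 < 2^-1 :> R /\ 2^-1 <= 1 :> R by split; lra.
have quarter : 0 < 4^-1 :> R /\ 4^-1 <= 1 :> R by split; lra.
have one : 0 < 1 :> R /\ 1 <= 1 :> R by [].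
have mscZ (k t : R) : 0 < t /\ t <= 1 ->
    measurable_field K (fun x => k *: Z t x).
  by move=> [t0 t1]; apply: measurable_fieldZ => //; exact: mZ.
have leZ (k t : R) : 0 < t /\ t <= 1 ->
    (normv_Lp K p%:E (fun x => k *: Z t x) <=
     (`|k| * t `^ (1 - 2 / p))%:E * normv_Lp K p%:E F)%E.
  move=> [t0 t1]; rewrite normv_LpZ//; last exact: mZ.
  rewrite EFinM -muleA lee_wpmul2l ?lee_fin//.
  exact: normv_Lp_zoom.
have -> : normv_Lp K p%:E q = normv_Lp K p%:E (fun x =>
    3^-1 *: Z 1 x + (- 2) *: Z 2^-1 x + (8 / 3) *: Z 4^-1 x).
  apply: eq_normv_Lp_ae => //.
    apply: measurable_fieldD; last exact: mscZ.
    by apply: measurable_fieldD; exact: mscZ.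
  (* Lagrange interpolation at 0, with nodes 1, 1/2 and 1/4. *)
  have := hq _ half.1 half.2; have := hq _ quarter.1 quarter.2.
  apply: filterS2 => x + + Kx => /(_ Kx) h4 /(_ Kx) h2.
  rewrite /Z /F h2 h4 dilate1 !dilateE.
  by apply: injective_projections; rewrite /= /GRing.scale/=; field.
apply: le_trans (normv_LpD p1 mK _ (mscZ _ _ quarter)) _.
  by apply: measurable_fieldD; exact: mscZ.
apply: le_trans (leeD2r _ (normv_LpD p1 mK (mscZ _ _ one) (mscZ _ _ half))) _.
apply: le_trans (leeD (leeD (leZ _ _ one) (leZ _ _ half)) (leZ _ _ quarter)) _.
rewrite -!ge0_muleDl ?lee_fin ?addr_ge0 ?mulr_ge0 ?powR_ge0 ?normr_ge0//.
by rewrite -!EFinD powR1 normrN !ger0_norm// mulr1.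
Qed.

End homogeneous_field.

(** The Jacobian contributes [t `^ (2 / p)] and the homogeneity of [q] contributes
[t^-1]. *)
Lemma normv_Lp_homogeneous (R : realType) (p : R) (c : R * R) (t : R)
    (K : set (mplane R)) (q : mplane R -> plane R) : 1 <= p -> 0 < t ->
  measurable K -> measurable_field K q ->
  measurable_field (dilate c t @^-1` K) q ->
  {ae leb2 R, forall x, K (dilate c t x) -> q (dilate c t x) = t^-1 *: q x} ->
  normv_Lp K p%:E q =
    ((t `^ (2 / p - 1))%:E * normv_Lp (dilate c t @^-1` K) p%:E q)%E.
Proof.
move=> p1 t0 mK mq mq0 hq.
have mdil := measurable_dilate c t.
have mK0 : measurable (dilate c t @^-1` K : set (mplane R)).
  by rewrite -[X in measurable X]setTI; exact: mdil.
rewrite (normv_Lp_dilate p1 c t0 mK mq).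
rewrite (@eq_normv_Lp_ae _ _ p1 _ _ (fun x => t^-1 *: q x) mK0)//; first last.
- exact: measurable_fieldZ.
- exact: measurable_field_comp.
rewrite normv_LpZ// gtr0_norm ?invr_gt0// muleA -EFinM.
by rewrite -(powR_inv1 (ltW t0)) -powRD// (gt_eqF t0) implybT.
Qed.

(** * Triangles *)

Section triangles.
Variable R : realType.
Implicit Types (K : triangle R) (x v w : R * R).

Definition cross v w : R := v.1 * w.2 - v.2 * w.1.

(** The barycentric coordinate of [x] at vertex [i] as a ratio of signed areas. The
numerator is affine in [x], although it is a product of two affine functions. *)
Definition bary_coord K (i : 'I_3) x : R :=
  cross (tnth K (ordS i) - x) (tnth K (ordS (ordS i)) - x) /
  cross (tnth K (inord 1) - tnth K (inord 0))
        (tnth K (inord 2) - tnth K (inord 0)).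

Lemma ord3_cases (P : 'I_3 -> Prop) :
  P (inord 0) -> P (inord 1) -> P (inord 2) -> forall i, P i.
Proof.
move=> P0 P1 P2 [[|[|[|//]]] i3].
- by move: P0; congr P; apply: val_inj; rewrite /= inordK.
- by move: P1; congr P; apply: val_inj; rewrite /= inordK.
- by move: P2; congr P; apply: val_inj; rewrite /= inordK.
Qed.

Lemma ordS3 : [/\ ordS (inord 0) = inord 1 :> 'I_3,
  ordS (inord 1) = inord 2 :> 'I_3 & ordS (inord 2) = inord 0 :> 'I_3].
Proof. by split; apply: val_inj; rewrite /= !inordK. Qed.

Lemma sum_ord3 (V : nmodType) (F : 'I_3 -> V) :
  \sum_i F i = F (inord 0) + F (inord 1) + F (inord 2).
Proof.
rewrite !big_ord_recl big_ord0 addr0 addrA.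
by congr (F _ + F _ + F _); apply: val_inj; rewrite /= inordK.
Qed.

(** Describing the triangle by strict inequalities between continuous affine
functions gives at once that it is open and that it is star-shaped. *)
Lemma open_triE K : proper_triangle K ->
  open_tri K = [set x | forall i, 0 < bary_coord K i x].
Proof.
have [S0 S1 S2] := ordS3.
rewrite /proper_triangle; set v0 := tnth K (inord 0).
set v1 := tnth K (inord 1); set v2 := tnth K (inord 2) => D0.
have coordE l x : \sum_i l i = 1 -> x = barycenter K l ->
    forall i, bary_coord K i x = l i.
  rewrite /barycenter !sum_ord3 -/v0 -/v1 -/v2 => sl xE.
  have l0 : l (inord 0) = 1 - l (inord 1) - l (inord 2) by lra.
  have x1 : x.1 = l (inord 0) * v0.1 + l (inord 1) * v1.1 + l (inord 2) * v2.1.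
    by rewrite xE.
  have x2 : x.2 = l (inord 0) * v0.2 + l (inord 1) * v1.2 + l (inord 2) * v2.2.
    by rewrite xE.
  apply: ord3_cases; rewrite /bary_coord ?(S0, S1, S2) -/v0 -/v1 -/v2 /cross/=;
    by rewrite x1 x2 ?l0; field.
apply/seteqP; split => [x [l [l0 sl xE]] i|x x0] /=.
  by rewrite (coordE l).
exists (bary_coord K ^~ x); split => //.
  by rewrite sum_ord3 /bary_coord ?(S0, S1, S2) -/v0 -/v1 -/v2 /cross/=; field.
rewrite /barycenter sum_ord3 /bary_coord ?(S0, S1, S2) -/v0 -/v1 -/v2 /cross.
by apply: injective_projections; rewrite /= /GRing.scale/=; field.
Qed.

(** [dilate c t x] is the barycentre of [c] and [x] with weights [1 - t] and [t], and
[bary_coord K i] is affine. *)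
Lemma bary_coord_dilate K i (c x : R * R) t :
  bary_coord K i (dilate c t x) =
  (1 - t) * bary_coord K i c + t * bary_coord K i x.
Proof.
rewrite /bary_coord !mulrA -mulrDl dilateE; congr (_ / _).
by rewrite /cross/=; ring.
Qed.

Lemma bary_coord_continuous K i : continuous (bary_coord K i : R * R -> R).
Proof.
have cfst : continuous (fst : R * R -> R) by move=> x; exact: cvg_fst.
have csnd : continuous (snd : R * R -> R) by move=> x; exact: cvg_snd.
move=> x; rewrite /bary_coord /cross; apply: cvgM; last exact: cvg_cst.
by apply: cvgB; apply: cvgM => /=; apply: cvgB; try exact: cvg_cst;
  [exact: cfst|exact: csnd|exact: csnd|exact: cfst].
Qed.

Lemma open_tri_open K : proper_triangle K -> open (open_tri K).
Proof.
move=> /open_triE ->; rewrite openE => x /= x0.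
suff : \forall y \near x, forall i, 0 < bary_coord K i y by [].
apply: (@filter_forall _ _ (fun i y => 0 < bary_coord K i y) _
  (nbhs_filter x)) => i.
apply: open_nbhs_nbhs; split; last exact: x0.
apply: (@open_comp _ _ (bary_coord K i) [set y | 0 < y]); last exact: open_gt.
by move=> y _; exact: bary_coord_continuous.
Qed.

Lemma closure_open_tri_bary K x i : proper_triangle K ->
  closure (open_tri K) x -> 0 <= bary_coord K i x.
Proof.
move=> pK Kx.
have cl : closed [set y : R * R | 0 <= bary_coord K i y].
  apply: (@closed_comp _ _ (bary_coord K i) [set y | 0 <= y]).
    by move=> y _; exact: bary_coord_continuous.
  exact: closed_ge.
suff /(_ x Kx) : closure (open_tri K) `<=` [set y | 0 <= bary_coord K i y] by [].
rewrite [X in _ `<=` X]((closure_id _).1 cl); apply: closureS.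
by rewrite open_triE// => y /= y0; exact: ltW.
Qed.

(** The point [c] may lie on the boundary: its barycentric coordinates are then only
nonnegative, and those of [x] keep the combination positive. *)
Lemma open_tri_star K c t x : proper_triangle K -> closure (open_tri K) c ->
  0 < t -> t <= 1 -> open_tri K x -> open_tri K (dilate c t x).
Proof.
move=> pK Kc t0 t1; rewrite [X in X -> _](_ : _ =
  (forall i, 0 < bary_coord K i x)); last by rewrite open_triE.
move=> x0; rewrite open_triE// => i /=.
rewrite bary_coord_dilate; apply: ltr_wpDl; last exact: mulr_gt0.
by rewrite mulr_ge0 ?subr_ge0//; exact: closure_open_tri_bary.
Qed.

Lemma open_tri_bounded K :
  exists2 M : R, 0 < M & forall x, open_tri K x -> `|x| <= M.
Proof.
exists (1 + \sum_i `|tnth K i|); first by rewrite ltr_pwDl// sumr_ge0.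
move=> _ [l [l0 sl ->]]; apply: le_trans (ler_norm_sum _ _ _) _.
apply: ler_wpDl => //; apply: ler_sum => i _.
rewrite normrZ ger0_norm; last exact: ltW.
rewrite ler_piMl// -sl (bigD1 i)//= lerDl sumr_ge0// => j _; exact: ltW.
Qed.

End triangles.

(** * Measurability of the modified flux *)

Section modified_flux.
Variable R : realType.

Lemma measurable_mxact (D : set (mplane R)) (A : mplane R -> 'M[R]_2)
    (G : mplane R -> plane R) : (forall i j, measurable_fun D (fun x => A x i j)) ->
  measurable_field D G -> measurable_field D (fun x => mxact (A x) (G x)).
Proof.
move=> mA [G1 G2].
have E k x : (A x *m colv (G x)) k ord0 =
    A x k ord0 * (G x).1 + A x k (lift ord0 ord0) * (G x).2.
  by rewrite mxE !big_ord_recl big_ord0 addr0 !mxE.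
by split; rewrite /mxact/=; under eq_fun do rewrite E;
  apply: measurable_funD; apply: measurable_funM.
Qed.

(** The quotient by the square of the norm is read as a power with exponent -1,
which is a measurable function on the whole line. *)
Lemma measurable_f2 (D : set (mplane R)) (x0 : R * R) :
  measurable_field D (f2 x0).
Proof.
have mx : measurable_field D (fun x => x - x0).
  apply: measurable_fieldB; first exact: measurable_field_id.
  exact: measurable_field_cst.
apply: measurable_fieldZ => //; apply: measurable_funM => //.
under eq_fun do rewrite -powR_inv1 ?exprn_ge0 ?enorm_ge0//.
apply: (measurableT_comp (measurable_powR (-1))) => //.
by apply: measurable_funX; exact: measurable_enorm.
Qed.

Lemma measurable_modified_flux (D : set (mplane R)) (A : mplane R -> 'M[R]_2)
    (x0 : R * R) (G : mplane R -> plane R) :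
  (forall i j, measurable_fun D (fun x => A x i j)) ->
  measurable_field D G -> measurable_field D (modified_flux A x0 G).
Proof.
move=> mA mG; apply: measurable_fieldB; last exact: measurable_f2.
have [m1 m2] := measurable_mxact mA mG.
by split; exact: measurable_funN.
Qed.

End modified_flux.

(** * Scaled copies of a reference element *)

Section reference_element.
Variable R : realType.

Lemma dilate_affine_image (c : R * R) (s t : R) (K1 K K' : set (R * R)) :
  0 < s -> 0 < t ->
  K = [set c + s *: y | y in K1] -> K' = [set c + t *: y | y in K1] ->
  dilate c (t / s) @^-1` K' = K.
Proof.
move=> s0 t0 -> ->; have s_neq0 : s != 0 by rewrite gt_eqF.
have t_neq0 : t != 0 by rewrite gt_eqF.
apply/seteqP; split => x /=; rewrite /dilate.
  move=> [y K1y /addrI yE]; exists y => //.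
  have -> : s *: y = x - c; last by rewrite addrC subrK.
  apply: (scalerI (a := t / s)); first by rewrite mulf_neq0 ?invr_eq0.
  by rewrite -yE scalerA divfK.
move=> [y K1y <-]; exists y => //.
by rewrite [c + _ - c]addrC addKr scalerA divfK.
Qed.

(** This turns smallness of the element size into inclusion of the element in the
neighbourhood on which the singular field is defined. *)
Lemma small_affine_image_sub (c : R * R) (K1 N : set (R * R)) (M : R) :
  0 < M -> (forall y, K1 y -> `|y| <= M) -> open N -> N c ->
  exists2 h0 : R, 0 < h0 & forall h, 0 < h -> h < h0 ->
    [set c + h *: y | y in K1] `<=` N.
Proof.
move=> M0 K1M oN Nc.
have /nbhs_ballP[r /= r0 rN] : nbhs c N by exact: open_nbhs_nbhs.
exists (r / M); first by rewrite divr_gt0.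
move=> h hgt0 hr _ [y K1y <-]; apply: rN.
rewrite -ball_normE /= opprD addNKr normrN normrZ gtr0_norm//.
by rewrite (le_lt_trans (ler_wpM2l (ltW hgt0) (K1M _ K1y)))// -ltr_pdivlMr.
Qed.

End reference_element.

(** * The lower bound *)

Theorem corollary5p3 (R : realType) (Om : set (R * R)) (x0 : R * R)
  (p alpha beta : R) (A : R * R -> 'M[R]_2)
  (f1 : R * R -> R) (g : hplane R -> R)
  (u : R * R -> R) (gradu : R * R -> R * R)
  (I : Type) (T : I -> seq (triangle R))
  (sigmah : I -> R * R -> R * R) (uh : I -> R * R -> R)
  (K1 : triangle R) (K : I -> triangle R) (h : I -> R)
  (N : set (R * R)) (q : R * R -> R * R) (sigmat : I -> R * R -> R * R) :
  let sigma := modified_flux A x0 gradu in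
  1 < p -> p < 2 ->
  bounded_sc_lipschitz_domain Om -> Om x0 ->
  0 < alpha -> alpha <= beta -> elliptic_matrix Om A alpha beta ->
  in_Lp (leb2 R) Om p%:E f1 ->
  in_Wsp_bdry Om (1 - p^-1) p g ->
  is_unique_weak_solution Om p A x0 f1 g u gradu ->
  (forall i, triangulation Om (T i)) -> shape_regular T ->
  (forall i, is_unique_discrete_solution Om (T i) A x0 f1 g (sigmah i) (uh i)) ->
  proper_triangle K1 -> closure (open_tri K1) 0 -> ediam (open_tri K1) = 1%E ->
  (forall i, [/\ K i \in T i, closure (open_tri (K i)) x0, 0 < h i
    & open_tri (K i) = [set x0 + h i *: y | y in open_tri K1]]) ->
  open N -> N x0 -> inv_Lp N p%:E q ->
  (forall t, 0 < t -> t <= 1 ->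
    {ae leb2 R, forall x : R * R, N x -> N (x0 + t *: (x - x0)) ->
      q (x0 + t *: (x - x0)) = t^-1 *: q x}) ->
  (forall i, open_tri (K i) `<=` N ->
    ~ {ae leb2 R, forall x, open_tri (K i) x -> q x = 0}) ->
  (forall i, open_tri (K i) `<=` N ->
    inv_Lp (open_tri (K i)) p%:E (sigmat i) /\
    {ae leb2 R, forall x, open_tri (K i) x -> sigma x = q x + sigmat i x}) ->
  (forall eps, 0 < eps -> exists2 delta, 0 < delta & forall i, h i < delta ->
    (normv_Lp (open_tri (K i)) p%:E (sigmat i)
       <= (eps * h i `^ (2 / p - 1))%:E)%E) ->
  exists2 c : R, 0 < c & exists2 h0 : R, 0 < h0 & forall i, h i < h0 ->
    (forall tauh, in_RT0 Om (T i) tauh ->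
      ((c * h i `^ (2 / p - 1))%:E
         <= normv_Lp Om p%:E (fun x => (sigma x - tauh x)%R))%E) /\
    ((c * h i `^ (2 / p - 1))%:E
       <= normv_Lp Om p%:E (fun x => (sigma x - sigmah i x)%R))%E.
Proof.
move=> sigma p1 p2 [oOm _ _ _ _] _ _ _ [mA _] _ _.
move=> [[[_ [mG1 mG2 _] _] _ _] _] triT _ disc.
move=> pK1 _ _ hK oN Nx0 [mq1 mq2 qfin] qhom qn0 split_sigma osigma.
have p1' : 1 <= p by exact: ltW.
have mN : measurable (N : set (mplane R)) by exact: plane_open_measurable.
have mq : measurable_field N q by [].
have msigma : measurable_field Om sigma.
  by apply: measurable_modified_flux => // i j; have [] := mA i j.
have pK i : proper_triangle (K i).
  by have [KT _ _ _] := hK i; have [_ /(_ _ KT)[]] := triT i.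
have mK i : measurable (open_tri (K i) : set (mplane R)).
  by apply: plane_open_measurable; apply: open_tri_open.
have KOm i : open_tri (K i) `<=` Om.
  by have [KT _ _ _] := hK i; have [_ /(_ _ KT)[]] := triT i.
have mOm : measurable (Om : set (mplane R)).
  exact: plane_open_measurable.
have [M M0 K1M] := open_tri_bounded K1.
have [hN hN0 KN'] := small_affine_image_sub M0 K1M oN Nx0.
have KN i : h i < hN -> open_tri (K i) `<=` N.
  by move=> hi; have [_ _ h0 ->] := hK i; exact: KN'.
(* A constant is read off from one fixed element [K i0] contained in [N]; if no
   element is that small, the bound holds vacuously below [hN]. *)
have [[i0 i0N]|noi] := pselect (exists i, h i < hN); last first.
  by exists 1 => //; exists hN => // i hi; case: noi; exists i.
have starK i t x : 0 < t -> t <= 1 -> open_tri (K i) x ->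
    open_tri (K i) (dilate x0 t x).
  by have [_ Kx0 _ _] := hK i; exact: open_tri_star.
have h_gt0 i : 0 < h i by have [] := hK i.
pose Q0 := fine (normv_Lp (open_tri (K i0)) p%:E q).
have Q0E : normv_Lp (open_tri (K i0)) p%:E q = Q0%:E.
  rewrite fineK// ge0_fin_numE ?normv_Lp_ge0//.
  by apply: le_lt_trans qfin; apply: normv_LpS => //; exact: KN.
have Q00 : 0 < Q0.
  rewrite -lte_fin -Q0E lt_neqAle normv_Lp_ge0 andbT eq_sym.
  apply/eqP => /normv_Lp_eq0.
  move=> /(_ p1' (mK i0)) q0; apply: (qn0 i0); first exact: KN.
  by apply: q0; apply: measurable_fieldS mq => //; exact: KN.
pose C := zoom_cst p.
have C0 : 0 < C by exact: zoom_cst_gt0.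
(* Then [m * h i `^ (2 / p - 1)] is the norm of [q] on each smaller element. *)
pose m := Q0 * (h i0 `^ (2 / p - 1))^-1.
have m0 : 0 < m by rewrite mulr_gt0// invr_gt0 powR_gt0.
have c0 : 0 < m / (2 * C) by rewrite divr_gt0// mulr_gt0.
(* With this choice the remainder uses up half of the lower bound
   [m / C * h i `^ (2 / p - 1)], and the other half remains. *)
have [delta delta0 small] := osigma _ c0.
exists (m / (2 * C)) => //; exists (Num.min delta (h i0)).
  by rewrite lt_min delta0 h_gt0.
move=> i; rewrite lt_min => /andP[hdelta hi0].
have KiN : open_tri (K i) `<=` N by apply: KN; exact: lt_trans hi0 i0N.
have Ki0N : open_tri (K i0) `<=` N by exact: KN.
have mqi : measurable_field (open_tri (K i)) q by exact: measurable_fieldS mq.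
have [[mt1 mt2 _] sigmaE] := split_sigma i KiN.
have mt : measurable_field (open_tri (K i)) (sigmat i) by [].
have qE : normv_Lp (open_tri (K i)) p%:E q = (m * h i `^ (2 / p - 1))%:E.
  have dilK : dilate x0 (h i / h i0) @^-1` open_tri (K i) = open_tri (K i0).
    have [_ _ _ Ki0E] := hK i0; have [_ _ _ KiE] := hK i.
    exact: dilate_affine_image Ki0E KiE.
  have t0 : 0 < h i / h i0 by rewrite divr_gt0.
  rewrite (@normv_Lp_homogeneous _ _ x0 _ _ _ p1' t0)//; last 2 first.
  - by rewrite dilK; exact: measurable_fieldS mq.
  - have := qhom _ t0; rewrite ler_pdivrMr// mul1r ltW// => /(_ isT).
    apply: (@filterS _ _ (ae_filter_ringOfSetsType (leb2 R))) => x qx Kx.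
    apply: qx; last exact: KiN.
    by apply: Ki0N; rewrite -dilK.
  rewrite dilK Q0E -EFinM; congr EFin.
  rewrite powRM ?invr_ge0 ?ltW// -(powR_inv1 (ltW (h_gt0 i0))) -powRrM.
  rewrite mulN1r powRN /m.
  by ring.
have lower tau : in_RT0 Om (T i) tau ->
    ((m / (2 * C) * h i `^ (2 / p - 1))%:E
       <= normv_Lp Om p%:E (fun x => (sigma x - tau x)%R))%E.
  move=> [[[mtau1 mtau2 _] _] affine].
  have mtau : measurable_field Om tau by [].
  have [KT _ _ _] := hK i; have [a [b tauE]] := affine _ KT.
  have mst : measurable_field Om (fun x => sigma x - tau x).
    exact: measurable_fieldB.
  have mstK := measurable_fieldS mOm (KOm i) mst.
  apply: le_trans (normv_LpS p1' (mK i) mOm mst (KOm i)).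
  set X := normv_Lp _ _ _.
  have X0 : (0 <= X)%E by exact: normv_Lp_ge0.
  have mRT : measurable_field (open_tri (K i)) (fun x => q x - (a + b *: x)).
    apply: measurable_fieldB => //; apply: measurable_fieldD.
      exact: measurable_field_cst.
    by apply: measurable_fieldZ => //; exact: measurable_field_id.
  have : (normv_Lp (open_tri (K i)) p%:E (fun x => q x - (a + b *: x))%R <=
          X + normv_Lp (open_tri (K i)) p%:E (sigmat i))%E.
    rewrite -[normv_Lp _ _ (sigmat i)]mul1e -normrN1 -normv_LpZ//.
    apply: le_trans (normv_LpD p1' (mK i) mstK _); last first.
      exact: measurable_fieldZ.
    rewrite (@eq_normv_Lp_ae _ _ p1' _ _
      (fun x => sigma x - tau x + -1 *: sigmat i x))//.
      apply: measurable_fieldD => //; exact: measurable_fieldZ.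
    apply: (@filterS _ _ (ae_filter_ringOfSetsType (leb2 R))) sigmaE => x.
    move=> + Kx => /(_ Kx) ->.
    by rewrite tauE// scaleN1r addrAC addrK.
  move=> /le_trans/(_ (leeD2l _ (small _ hdelta))) le1.
  have := homogeneous_RT_distance p1' (mK i) (@starK i) a b mqi.
  rewrite qE => le2; have /le2 : forall t, 0 < t -> t <= 1 ->
      {ae leb2 R, forall x, open_tri (K i) x ->
        q (dilate x0 t x) = t^-1 *: q x}.
    move=> t t0 t1; have := qhom t t0 t1.
    apply: (@filterS _ _ (ae_filter_ringOfSetsType (leb2 R))) => x qx Kx.
    by apply: qx; apply: KiN => //; exact: starK.
  have C0' : (0 <= C%:E)%E by rewrite lee_fin ltW.
  move=> {}le2; have := le_trans le2 (lee_wpmul2l C0' le1).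
  case: X X0 {le1 le2} => [X _||]//; last by move=> _ _; rewrite leey.
  rewrite -EFinD -EFinM !lee_fin -/C => H.
  rewrite -(ler_pM2l C0).
  have -> : C * (m / (2 * C) * h i `^ (2 / p - 1)) = m * h i `^ (2 / p - 1) / 2.
    by field; rewrite gt_eqF.
  have : C * (X + m / (2 * C) * h i `^ (2 / p - 1)) =
      C * X + m * h i `^ (2 / p - 1) / 2 by field; rewrite gt_eqF.
  by lra.
split; first exact: lower.
by apply: lower; have [[]] := disc i.
Qed.
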